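(* Let $A \in \mathbb{R}^{m \times n}$ and $b \in \mathbb{R}^m$. Fix $\gamma > 1$ and set $s = \lceil \gamma n \rceil$. Let $G \in \mathbb{R}^{s \times m}$ be a random matrix whose entries are independent standard normal random variables, let $\tilde A = G A$, and let $\tilde A = \tilde U \tilde \Sigma \tilde V^{T}$ be an economy-sized SVD of $\tilde A$, with $\tilde r = \operatorname{rank}(\tilde A)$, $\tilde\Sigma \in \mathbb{R}^{\tilde r \times \tilde r}$ diagonal with positive diagonal entries and $\tilde V \in \mathbb{R}^{n \times \tilde r}$ with orthonormal columns. Let $N = \tilde V \tilde \Sigma^{-1}$, let $\hat y$ be the min-length solution of $\min_y \|A N y - b\|_2$, and let $\hat x = N \hat y$. Then $\hat x = A^\dagger b$ almost surely.
   Context: $A^\dagger$ is the Moore–Penrose pseudoinverse of $A$; $A^\dagger b$ is the min-length solution of $\min_x \|Ax-b\|_2$. The min-length solution of a least squares problem is the minimizer of least Euclidean norm. *)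

(* Defs.v *)
From HB Require Import structures.
From mathcomp Require Import all_boot all_order all_algebra.
From mathcomp Require Import all_classical all_reals all_analysis.

Set Implicit Arguments.
Unset Strict Implicit.
Unset Printing Implicit Defensive.

Import Order.TTheory GRing.Theory Num.Theory.
Local Open Scope classical_set_scope.
Local Open Scope ring_scope.

(* The library norm on matrices is the sup norm, hence this definition. *)
Definition norm2 (R : realType) (n : nat) (x : 'cV[R]_n) : R :=
  Num.sqrt (\sum_(i < n) x i ord0 ^+ 2).

Definition lsq_solution (R : realType) (m n : nat)
    (A : 'M[R]_(m, n)) (b : 'cV[R]_m) (x : 'cV[R]_n) : Prop :=
  forall z : 'cV[R]_n, norm2 (A *m x - b) <= norm2 (A *m z - b).

Definition min_length_solution (R : realType) (m n : nat)
    (A : 'M[R]_(m, n)) (b : 'cV[R]_m) (x : 'cV[R]_n) : Prop :=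
  lsq_solution A b x /\
  forall z : 'cV[R]_n, lsq_solution A b z -> norm2 x <= norm2 z.

Definition penrose (R : realType) (m n : nat)
    (A : 'M[R]_(m, n)) (X : 'M[R]_(n, m)) : Prop :=
  [/\ A *m X *m A = A, X *m A *m X = X,
      (A *m X)^T = A *m X & (X *m A)^T = X *m A].

(* Not the library's [pinvmx], which is only some partial inverse. The default
   value 0 is never used, see [mppinvP]. *)
Definition mppinv (R : realType) (m n : nat) (A : 'M[R]_(m, n)) : 'M[R]_(n, m) :=
  xget 0 [set X | penrose A X].

(* The inner dimension of an economy-sized SVD is the rank, so that the
   singular values on the diagonal of S are nonzero. *)
Definition economy_svd (R : realType) (s n : nat) (A : 'M[R]_(s, n))
    (U : 'M[R]_(s, \rank A)) (S : 'M[R]_(\rank A)) (V : 'M[R]_(n, \rank A)) :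
    Prop :=
  [/\ U^T *m U = 1%:M, V^T *m V = 1%:M,
      is_diag_mx S, (forall i, 0 < S i i) & A = U *m S *m V^T].
Arguments economy_svd {R s n} A U S V.

Definition mutually_independent (d : measure_display) (T : measurableType d)
    (R : realType) (P : probability T R) (I : finType)
    (X : I -> {RV P >-> R}) : Prop :=
  forall (J : {set I}) (B : I -> set R),
    (forall i, i \in J -> measurable (B i)) ->
    P (\bigcap_(i in [set i | i \in J]) (X i @^-1` B i)) =
    (\prod_(i in J) P (X i @^-1` B i))%E.

Definition standard_normal (d : measure_display) (T : measurableType d)
    (R : realType) (P : probability T R) (X : {RV P >-> R}) : Prop :=
  forall B : set R, measurable B -> distribution P X B = normal_prob 0 1 B.

Definition gaussian_entries (d : measure_display) (T : measurableType d)
    (R : realType) (P : probability T R) (s m : nat)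
    (G : 'I_s -> 'I_m -> {RV P >-> R}) : Prop :=
  (forall i j, standard_normal (G i j)) /\
  mutually_independent (fun ij : 'I_s * 'I_m => G ij.1 ij.2).

Definition random_mx (d : measure_display) (T : measurableType d)
    (R : realType) (P : probability T R) (s m : nat)
    (G : 'I_s -> 'I_m -> {RV P >-> R}) (w : T) : 'M[R]_(s, m) :=
  \matrix_(i < s, j < m) G i j w.

Section Pseudoinverse.
Variable R : realType.

Lemma gram_eq0 (m n : nat) (A : 'M[R]_(m, n)) : A *m A^T = 0 -> A = 0.
Proof.
move=> A0; apply/matrixP => i j; rewrite [RHS]mxE.
have /eqP := congr1 (fun M : 'M[R]_m => M i i) A0.
rewrite !mxE psumr_eq0 => [/allP/(_ j (mem_index_enum _))|k _].
  by rewrite mxE mulf_eq0 orbb => /eqP.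
by rewrite mxE -expr2 sqr_ge0.
Qed.

Lemma gram_unitmx (m n : nat) (F : 'M[R]_(m, n)) :
  row_free F -> F *m F^T \in unitmx.
Proof.
move=> Ffree; rewrite -row_free_unit; apply: inj_row_free => v vF0.
suff: v *m F = 0 by move/eqP; rewrite mulmx_free_eq0 // => /eqP.
by apply: gram_eq0; rewrite trmx_mul mulmxA -(mulmxA v) vF0 mul0mx.
Qed.

Lemma penrose_exists (m n : nat) (A : 'M[R]_(m, n)) : exists X, penrose A X.
Proof.
have [r [C [F [AE Cfree Ffree]]]] :
    exists r (C : 'M[R]_(m, r)) (F : 'M[R]_(r, n)),
      [/\ A = C *m F, row_free C^T & row_free F].
  exists (\rank A), (col_base A), (row_base A); split.
  - by rewrite mulmx_base.
  - by rewrite /row_free mxrank_tr; exact: col_base_full.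
  - exact: row_base_free.
pose K := C^T *m C; pose L := F *m F^T.
have uL : L \in unitmx by exact: gram_unitmx.
have uK : K \in unitmx by rewrite /K -{2}[C]trmxK; exact: gram_unitmx.
have sK : (invmx K)^T = invmx K by rewrite trmx_inv trmx_mul trmxK.
have sL : (invmx L)^T = invmx L by rewrite trmx_inv trmx_mul trmxK.
pose X := F^T *m invmx L *m invmx K *m C^T.
have AX : A *m X = C *m invmx K *m C^T.
  by rewrite AE /X !mulmxA -(mulmxA C F) -/L mulmxK.
have XA : X *m A = F^T *m invmx L *m F.
  by rewrite AE /X !mulmxA -(mulmxA _ C^T C) -/K mulmxKV.
exists X; split.
- by rewrite AX AE !mulmxA -(mulmxA _ C^T C) -/K mulmxKV.
- by rewrite XA /X !mulmxA -(mulmxA _ F F^T) -/L mulmxKV.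
- by rewrite AX !trmx_mul trmxK sK mulmxA.
- by rewrite XA !trmx_mul trmxK sL mulmxA.
Qed.

Lemma penrose_unique (m n : nat) (A : 'M[R]_(m, n)) (X Y : 'M[R]_(n, m)) :
  penrose A X -> penrose A Y -> X = Y.
Proof.
move=> [X1 X2 X3 X4] [Y1 Y2 Y3 Y4].
have AXY : A *m X = A *m Y.
  rewrite -[LHS]X3 -{1}Y1 -(mulmxA (A *m Y)) trmx_mul X3 Y3.
  by rewrite mulmxA X1.
have XYA : X *m A = Y *m A.
  rewrite -[LHS]X4 -{1}Y1 -mulmxA mulmxA trmx_mul Y4 X4.
  by rewrite -mulmxA (mulmxA A) X1.
by rewrite -X2 XYA -mulmxA AXY mulmxA Y2.
Qed.

Lemma mppinvP (m n : nat) (A : 'M[R]_(m, n)) : penrose A (mppinv A).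
Proof. by have [X AX] := penrose_exists A; exact: (xgetI 0 AX). Qed.

Let sqn (n : nat) (x : 'cV[R]_n) : R := \sum_(i < n) x i ord0 ^+ 2.

Let sqnE (n : nat) (x : 'cV[R]_n) : sqn x = (x^T *m x) ord0 ord0.
Proof. by rewrite mxE; apply: eq_bigr => i _; rewrite mxE expr2. Qed.

Let sqn_ge0 (n : nat) (x : 'cV[R]_n) : 0 <= sqn x.
Proof. by apply: sumr_ge0 => i _; exact: sqr_ge0. Qed.

Let sqn_le0 (n : nat) (x : 'cV[R]_n) : sqn x <= 0 -> x = 0.
Proof.
move=> x0; have {x0} /eqP : sqn x = 0 by apply/le_anti; rewrite x0 sqn_ge0.
rewrite psumr_eq0 => [/allP x0|i _]; last exact: sqr_ge0.
apply/colP => i; rewrite [RHS]mxE.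
by have := x0 i (mem_index_enum _); rewrite sqrf_eq0 => /eqP.
Qed.

Let sqnD (n : nat) (x y : 'cV[R]_n) :
  x^T *m y = 0 -> sqn (x + y) = sqn x + sqn y.
Proof.
move=> xy; have yx : y^T *m x = 0.
  by rewrite -[LHS]trmxK trmx_mul trmxK xy trmx0.
have tD : (x + y)^T = x^T + y^T by apply/matrixP => i j; rewrite !mxE.
by rewrite !sqnE tD mulmxDl !mulmxDr xy yx addr0 add0r [LHS]mxE.
Qed.

Let norm2_le (n p : nat) (x : 'cV[R]_n) (y : 'cV[R]_p) :
  (norm2 x <= norm2 y) = (sqn x <= sqn y).
Proof. by rewrite /norm2 ler_sqrt ?sqn_ge0. Qed.

Let residual (m n : nat) (A : 'M[R]_(m, n)) (b : 'cV[R]_m) (z : 'cV[R]_n) :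
  sqn (A *m z - b) = sqn (A *m (mppinv A *m b) - b) +
    sqn (A *m (z - mppinv A *m b)).
Proof.
have [X1 X2 X3 X4] := mppinvP A; set X := mppinv A in X1 X2 X3 X4 *.
rewrite [RHS]addrC -sqnD; first by rewrite mulmxBr addrA subrK.
have AtX : A^T *m (A *m X) = A^T by rewrite -{1}X3 -trmx_mul X1.
by rewrite trmx_mul -mulmxA mulmxBr (mulmxA A X) (mulmxA A^T) AtX subrr mulmx0.
Qed.

Let lsq_split (m n : nat) (A : 'M[R]_(m, n)) (b : 'cV[R]_m) (z : 'cV[R]_n) :
  lsq_solution A b z ->
  sqn z = sqn (mppinv A *m b) + sqn (z - mppinv A *m b).
Proof.
move/(_ (mppinv A *m b)); rewrite norm2_le residual gerDl => /sqn_le0 Az.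
have [X1 X2 X3 X4] := mppinvP A; set X := mppinv A in X1 X2 X3 X4 Az *.
rewrite -sqnD ?subrKC //.
by rewrite -{1}X2 -mulmxA trmx_mul X4 -!mulmxA Az !mulmx0.
Qed.

Lemma mppinv_min_length (m n : nat) (A : 'M[R]_(m, n)) (b : 'cV[R]_m) :
  min_length_solution A b (mppinv A *m b).
Proof.
split=> [z|z /lsq_split zE]; first by rewrite norm2_le (residual _ _ z) lerDl.
by rewrite norm2_le zE lerDl.
Qed.

Lemma min_length_solutionE (m n : nat) (A : 'M[R]_(m, n)) (b : 'cV[R]_m)
    (x : 'cV[R]_n) :
  min_length_solution A b x <-> x = mppinv A *m b.
Proof.
split=> [[/lsq_split xE xmin]|->]; last exact: mppinv_min_length.
have := xmin _ (mppinv_min_length A b).1.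
by rewrite norm2_le xE gerDl => /sqn_le0/eqP; rewrite subr_eq0 => /eqP.
Qed.

End Pseudoinverse.

(* Main.v *)
Require Import Defs.
From HB Require Import structures.
From mathcomp Require Import all_boot all_order all_algebra.
From mathcomp Require Import all_classical all_reals all_analysis.
From mathcomp Require Import measurable_realfun ring.

Set Implicit Arguments.
Unset Strict Implicit.
Unset Printing Implicit Defensive.

Import Order.TTheory GRing.Theory Num.Theory.
Local Open Scope classical_set_scope.
Local Open Scope ring_scope.

(** If [G *m A] has the rank of [A], the two matrices have the same row space,
    so [A = (A *m N) *m (S *m V^T)] with [A *m N] of full column rank, and
    [N *m mppinv (A *m N)] satisfies the Penrose equations of [A].

    For the rank, factor [A = C *m F] with [C] of full column rank and [F] of
    full row rank. The determinant of the first [\rank A] rows of [G *m C]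
    is affine in each entry of [G], and it is not identically zero: these rows
    of [G] can be chosen to be [C^T]. Such a function is almost surely nonzero,
    by induction on the number of variables: write it as [h + x * g] where
    [g] and [h] do not involve the variable [x]. If [g] is not identically zero,
    then almost surely [g <> 0], and [x = - h / g] has probability zero because
    [x] is atomless and independent of the other variables. *)

(** * Pseudoinverse through a preconditioner *)

Section Deterministic.
Variable R : realType.

(** [V *m V^T] fixes the rows of [A], so with [M := S *m V^T] and [B := A *m N] one has [A = B *m M]
    and [M *m N = 1]. The two products in the Penrose equations then become [B *m Y] and [V *m V^T],
    both symmetric. *)
Lemma mppinv_precond (m n r : nat) (A : 'M[R]_(m, n)) (V : 'M[R]_(n, r))
    (S : 'M[R]_r) :
  S \in unitmx -> V^T *m V = 1%:M -> (A <= V^T)%MS -> \rank A = r ->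
  mppinv A = V *m invmx S *m mppinv (A *m (V *m invmx S)).
Proof.
move=> uS VV AleV rankA.
have AV : A *m V *m V^T = A.
  by have /submxP[W ->] := AleV; rewrite -(mulmxA W) VV mulmx1.
set N := V *m invmx S; set B := A *m N; pose M := S *m V^T.
have MN : M *m N = 1%:M.
  by rewrite /M /N mulmxA -(mulmxA S) VV mulmx1 mulmxV.
have BM : B *m M = A by rewrite /B /M /N !mulmxA mulmxKV.
have [B1 B2 B3 B4] := mppinvP B; set Y := mppinv B in B1 B2 B3 B4 *.
(* [A = B *m M] forces the rank of [B] up to [r], so [B] can be cancelled on the left in
   [B *m Y *m B = B]. *)
have Bfull : row_full B.
  rewrite /row_full eqn_leq rank_leq_col -{1}rankA -{1}BM.
  exact: mxrankM_maxl.
have YB : Y *m B = 1%:M by apply: (row_full_inj Bfull); rewrite mulmxA B1 mulmx1.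
have XA : N *m Y *m A = V *m V^T.
  by rewrite -BM mulmxA -(mulmxA N) YB mulmx1 /N /M mulmxA mulmxKV.
apply: (penrose_unique (mppinvP A)); split.
- by rewrite (mulmxA A) -/B -{1}BM (mulmxA (B *m Y)) B1.
- by rewrite -BM -(mulmxA N Y) (mulmxA Y) YB mul1mx mulmxA -(mulmxA N M) MN mulmx1.
- by rewrite mulmxA.
- by rewrite XA trmx_mul trmxK.
Qed.

(** The row space of [G *m A] lies in that of [A] and in that of [V^T]; equality of ranks turns the
    first inclusion into an equality. *)
Lemma mppinv_sketch (m n s : nat) (A : 'M[R]_(m, n)) (G : 'M[R]_(s, m))
    (U : 'M[R]_(s, \rank (G *m A))) (S : 'M[R]_(\rank (G *m A)))
    (V : 'M[R]_(n, \rank (G *m A))) :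
  economy_svd (G *m A) U S V -> \rank (G *m A) = \rank A ->
  mppinv A = V *m invmx S *m mppinv (A *m (V *m invmx S)).
Proof.
move=> [_ VV diagS Spos GAE] rankGA; apply: mppinv_precond => //.
  have /diag_mxP[e Se] := diagS.
  rewrite Se unitmxE det_diag unitfE; apply/prodf_neq0 => i _.
  by have := Spos i; rewrite Se mxE eqxx mulr1n => /gt_eqF ->.
apply: (@submx_trans _ _ _ _ _ _ (G *m A)); last first.
  by apply/submxP; exists (U *m S).
by have [_ <-] := mxrank_leqif_sup (submxMl G A); rewrite rankGA.
Qed.

End Deterministic.

(** * Independence and null events *)

Section AlmostSure.
Context (d : measure_display) (T : measurableType d) (R : realType).
Variable P : probability T R.

(** By independence the joint law of [Y] and [X] is the product of their laws, so the probability is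
    an integral of probabilities of sections, all zero. *)
Lemma independent_null_section (d' : measure_display) (T' : measurableType d')
    (Y : {mfun T >-> T'}) (X : {RV P >-> R}) (E : set (T' * R)) :
  (forall A B, measurable A -> measurable B ->
    P (Y @^-1` A `&` X @^-1` B) = (P (Y @^-1` A) * P (X @^-1` B))%E) ->
  measurable E -> (forall y, P (X @^-1` xsection E y) = 0%E) ->
  P [set w | E (Y w, X w)] = 0%E.
Proof.
move=> indep mE E0.
have mYX : measurable_fun setT (fun w => (Y w, X w)).
  exact: measurable_fun_pair.
pose YX : {mfun T >-> (T' * R)%type} := mfun_Sub (mem_set mYX).
have EYX := @product_measure_unique _ _ _ _ R (distribution P Y)
  (distribution P X) (distribution P YX) indep E mE.
transitivity (distribution P YX E) => //.
by rewrite -EYX; apply: integral0_eq => y _; exact: E0.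
Qed.

Context (I : finType) (X : I -> {RV P >-> R}).
Hypothesis indepX : mutually_independent X.

(** A pi-system generating the sigma-algebra of the variables [X i] with [i] in [J]. *)
Definition cylinders (J : {set I}) : set (set T) :=
  [set E | exists2 B : I -> set R, forall i, measurable (B i) &
    E = \bigcap_(i in [set i | i \in J]) (X i @^-1` B i)].

Lemma cylinders_setI_closed (J : {set I}) : setI_closed (cylinders J).
Proof.
move=> _ _ [A mA ->] [B mB ->]; exists (fun i => A i `&` B i).
  by move=> i; exact: measurableI.
by rewrite -bigcapI.
Qed.

Lemma cylinders_measurable (J : {set I}) : cylinders J `<=` measurable.
Proof.
move=> _ [B mB ->]; apply: fin_bigcap_measurable; first exact: finite_finset.
by move=> i _; rewrite -[X in measurable X]setTI; exact: measurable_funPT.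
Qed.

Lemma sigma_cylinders_measurable (J : {set I}) :
  <<s cylinders J >> `<=` measurable.
Proof.
apply: smallest_sub; last exact: cylinders_measurable.
exact: sigma_algebra_measurable.
Qed.

(** Pi-lambda argument in [E]: the product rule passes to complements and disjoint countable unions,
    and holds for cylinders by mutual independence. *)
Lemma independent_cylinders (J : {set I}) (k : I) (E : set T) (B : set R) :
  k \notin J -> <<s cylinders J >> E -> measurable B ->
  P (E `&` X k @^-1` B) = (P E * P (X k @^-1` B))%E.
Proof.
move=> kJ sE mB.
have mXB : measurable (X k @^-1` B).
  by rewrite -[X in measurable X]setTI; exact: measurable_funPT.
have indepC (D : set T) : measurable D ->
    P (D `&` X k @^-1` B) = (P D * P (X k @^-1` B))%E ->
    P (~` D `&` X k @^-1` B) = (P (~` D) * P (X k @^-1` B))%E.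
  move=> mD QD; rewrite setIC -setDE measureD //; last first.
    by rewrite ltey_eq fin_num_measure.
  rewrite (setIC (X k @^-1` B)) /= QD probability_setC // muleBl ?mul1e //.
    by rewrite fin_num_measure.
have indepU (F : (set T)^nat) : (forall n, measurable (F n)) ->
    trivIset setT F ->
    (forall n, P (F n `&` X k @^-1` B) = (P (F n) * P (X k @^-1` B))%E) ->
    P (\bigcup_n F n `&` X k @^-1` B) =
      (P (\bigcup_n F n) * P (X k @^-1` B))%E.
  move=> mF tF QF.
  rewrite setI_bigcupl measure_semi_bigcup //; last 3 first.
  - by move=> n; exact: measurableI.
  - exact: trivIset_setIr.
  - by apply: bigcupT_measurable => n; exact: measurableI.
  rewrite [X in (X * _)%E]measure_semi_bigcup //; last exact: bigcupT_measurable.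
  have PB : P (X k @^-1` B) \is a fin_num by rewrite fin_num_measure.
  rewrite muleC -(fineK PB) -nneseriesZl //.
  by apply: eq_eseriesr => n _; rewrite /= QF muleC fineK.
pose T' := g_sigma_algebraType (cylinders J).
pose Q := [set E : set T' |
  P (E `&` X k @^-1` B) = (P E * P (X k @^-1` B))%E].
apply: (@dynkin_induction _ T' (cylinders J) Q) sE => //.
- exact: cylinders_setI_closed.
- by rewrite /Q /= setTI probability_setT mul1e.
- move=> _ [C mC ->]; rewrite /Q /=.
  (* Since [k] is outside [J], one family can hold both [B] and the sets [C i], which makes the
     intersection a cylinder over [k |: J]. *)
  pose D i := if i == k then B else C i.
  have mD i : measurable (D i) by rewrite /D; case: ifP.
  have CE : \bigcap_(i in [set i | i \in J]) X i @^-1` C i =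
            \bigcap_(i in [set i | i \in J]) X i @^-1` D i.
    apply: eq_bigcapr => i /= iJ; rewrite /D ifF //.
    by apply: contraNF kJ => /eqP <-.
  have -> : \bigcap_(i in [set i | i \in J]) X i @^-1` C i `&` X k @^-1` B =
            \bigcap_(i in [set i | i \in k |: J]) X i @^-1` D i.
    rewrite CE; apply/seteqP; split=> [w [wJ wk] i /=|w wkJ].
      by rewrite in_setU1 => /orP[/eqP ->|/wJ//]; rewrite /D /= eqxx.
    split=> [i /= iJ|]; first by apply: wkJ; rewrite /= in_setU1 iJ orbT.
    by have := wkJ k; rewrite /D /= eqxx; apply; rewrite setU11.
  rewrite CE !indepX; try by move=> *; exact: mD.
  by rewrite big_setU1 //= muleC; congr (_ * P (_ @^-1` _))%E; rewrite /D eqxx.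
- by move=> D /sigma_cylinders_measurable; exact: indepC.
- by move=> F mF; apply: indepU => n; exact: sigma_cylinders_measurable (mF n).
Qed.

End AlmostSure.

(** * Functions affine in each variable *)

Section Multiaffine.
Context (R : realType) (I : finType).
Implicit Types (f : (I -> R) -> R) (v : I -> R) (J : {set I}).

Definition upd v (k : I) (x : R) : I -> R := fun i => if i == k then x else v i.

(** Interpolation between the values at 0 and 1, so that the coefficients of a variable are
    expressed by restrictions of [f] itself. *)
Definition multiaffine f := forall v k x,
  f (upd v k x) = (1 - x) * f (upd v k 0) + x * f (upd v k 1).

Definition depends_on J f := forall u v, {in J, u =1 v} -> f u = f v.

Lemma upd_id v k : upd v k (v k) = v.
Proof. by apply/funext => i; rewrite /upd; case: eqP => [->|]. Qed.

Lemma upd_upd v k x y : upd (upd v k x) k y = upd v k y.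
Proof. by apply/funext => i; rewrite /upd; case: eqP. Qed.

Lemma upd_comm v j k x y :
  j != k -> upd (upd v j x) k y = upd (upd v k y) j x.
Proof.
move=> jk; apply/funext => i; rewrite /upd.
by have [->|//] := eqVneq i k; rewrite eq_sym (negPf jk).
Qed.

Lemma multiaffine_upd f k x :
  multiaffine f -> multiaffine (fun v => f (upd v k x)).
Proof.
move=> fA v j y; have [->|jk] := eqVneq j k; first by rewrite !upd_upd; ring.
by rewrite !(upd_comm _ _ _ jk) fA.
Qed.

Lemma multiaffineB f g :
  multiaffine f -> multiaffine g -> multiaffine (fun v => f v - g v).
Proof. by move=> fA gA v k x; rewrite fA gA; ring. Qed.

Lemma depends_on_upd f J k x :
  depends_on J f -> depends_on (J :\ k) (fun v => f (upd v k x)).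
Proof.
move=> fJ u v uv; apply: fJ => i iJ; rewrite /upd.
by have [//|ik] := eqVneq i k; apply: uv; rewrite in_setD1 ik.
Qed.

Lemma depends_on_setT f : depends_on [set: I]%SET f.
Proof.
by move=> u v uv; congr f; apply/funext => i; apply: uv; rewrite finset.in_setT.
Qed.

Lemma multiaffineE f v k : multiaffine f ->
  f v = f (upd v k 0) + v k * (f (upd v k 1) - f (upd v k 0)).
Proof. by move=> fA; rewrite -[in LHS](upd_id v k) fA; ring. Qed.

(** Induction on [#|J|], splitting off one variable at a time. Asking measurability of [Y i] only
    for [i] in [J] allows the sigma-algebra on [T] to be the one these variables generate. *)
Lemma measurable_multiaffine (d : measure_display) (T : measurableType d)
    (Y : I -> T -> R) J f :
  multiaffine f -> depends_on J f ->
  (forall i, i \in J -> measurable_fun setT (Y i)) ->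
  measurable_fun setT (fun w => f (Y^~ w)).
Proof.
move En : #|J| => n; elim: n => [|n IHn] in J En f *.
  move=> _ fJ _; have J0 := cards0_eq En.
  rewrite (_ : (fun _ => _) = cst (f (fun=> 0))); first exact: measurable_cst.
  by apply/funext => w; apply: fJ => i; rewrite J0 inE.
move=> fA fJ mY; have /set0Pn[k kJ] : J != finset.set0 by rewrite -card_gt0 En.
have mupd x : measurable_fun setT (fun w => f (upd (Y^~ w) k x)).
  apply: (IHn (J :\ k) _ (fun v => f (upd v k x))).
  - by move: En; rewrite (cardsD1 k) kJ => -[].
  - exact: multiaffine_upd.
  - exact: depends_on_upd.
  - by move=> i; rewrite in_setD1 => /andP[_ /mY].
rewrite (_ : (fun _ => _) = (fun w => f (upd (Y^~ w) k 0) +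
  Y k w * (f (upd (Y^~ w) k 1) - f (upd (Y^~ w) k 0)))); last first.
  by apply/funext => w; exact: multiaffineE.
apply: measurable_funD => //; apply: measurable_funM; first exact: mY.
exact: measurable_funB.
Qed.

Context (d : measure_display) (T : measurableType d) (P : probability T R).
Context (X : I -> {RV P >-> R}).

Lemma multiaffine_neq0_ae J f :
  mutually_independent X -> (forall i x, P (X i @^-1` [set x]) = 0%E) ->
  multiaffine f -> depends_on J f -> (exists v, f v != 0) ->
  P.-negligible [set w | f (X^~ w) = 0].
Proof.
move=> indepX X0.
move En : #|J| => n; elim: n => [|n IHn] in J En f *.
  move=> _ fJ [v fv]; have J0 := cards0_eq En.
  rewrite (_ : [set _ | _] = set0); first exact: negligible_set0.
  apply/seteqP; split=> // w /= fw; move/negP: fv; apply.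
  by rewrite -fw; apply/eqP/fJ => i; rewrite J0 inE.
move=> fA fJ [v fv]; have /set0Pn[k kJ] : J != finset.set0 by rewrite -card_gt0 En.
have cardJk : #|J :\ k| = n by move: En; rewrite (cardsD1 k) kJ => -[].
pose h v := f (upd v k 0); pose g v := f (upd v k 1) - f (upd v k 0).
have fE u : f u = h u + u k * g u by exact: multiaffineE.
have hA : multiaffine h by exact: multiaffine_upd.
have hJ : depends_on (J :\ k) h by exact: depends_on_upd.
have gA : multiaffine g by apply: multiaffineB; exact: multiaffine_upd.
have gJ : depends_on (J :\ k) g.
  by move=> u u' uu'; congr (_ - _); apply: depends_on_upd uu'.
(* If [g] vanishes identically, [f] coincides with [h], which takes a nonzero value and depends on
   fewer variables. *)
have [g0|/existsNP[v' /eqP gv']] := pselect (forall u, g u = 0).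
  have fh u : f u = h u by rewrite fE g0 mulr0 addr0.
  rewrite (_ : [set _ | _] = [set w | h (X^~ w) = 0]); last first.
    by apply/seteqP; split=> w /=; rewrite fh.
  by apply: (IHn (J :\ k)) => //; exists v; rewrite -fh.
have g_ae : P.-negligible [set w | g (X^~ w) = 0].
  by apply: (IHn (J :\ k)) => //; exists v'.
(* [T'] is [T] with the sigma-algebra of the variables in [J :\ k]. The identity [Y] from [T] to
   [T'] carries all of them at once and is independent of [X k]. *)
pose T' := g_sigma_algebraType (cylinders X (J :\ k)).
have mX i : i \in J :\ k -> measurable_fun setT (X i : T' -> R).
  move=> iJ _ B mB; rewrite setTI; apply: sub_sigma_algebra.
  exists (fun j => if j == i then B else setT).
    by move=> j; case: ifP.
  apply/seteqP; split=> [w wB j /= _|w /(_ i iJ)]; rewrite /preimage /=.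
    by have [->//|] := eqVneq j i.
  by rewrite eqxx.
have mh : measurable_fun setT (fun w : T' => h (X^~ w)).
  exact: measurable_multiaffine mX.
have mg : measurable_fun setT (fun w : T' => g (X^~ w)).
  exact: measurable_multiaffine mX.
have mid : measurable_fun setT (fun w : T => w : T').
  by move=> _ B mB; rewrite setTI; exact: sigma_cylinders_measurable mB.
pose Y : {mfun T >-> T'} := mfun_Sub (mem_set mid).
(* Excluding the zeros of [g] leaves in each section at most the point [- h / g]. *)
pose E := [set p : T' * R | h (X^~ p.1) + p.2 * g (X^~ p.1) = 0] `&`
  [set p : T' * R | g (X^~ p.1) <> 0].
have mE : measurable E.
  have mg1 : measurable_fun setT (fun p : T' * R => g (X^~ p.1)).
    exact: (measurableT_comp mg).
  apply: measurableI.
    rewrite -[X in measurable X]setTI.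
    have : measurable_fun setT
      (fun p : T' * R => h (X^~ p.1) + p.2 * g (X^~ p.1)).
      apply: measurable_funD; first exact: (measurableT_comp mh).
      exact: measurable_funM.
    by move=> /(_ measurableT [set 0]); apply.
  rewrite -[X in measurable X]setTI.
  by apply: (mg1 measurableT (~` [set 0])); exact: measurableC.
have E0 : P [set w | E (Y w, X k w)] = 0%E.
  apply: independent_null_section => // [A B mA mB|w].
    by apply: (independent_cylinders indepX (J := J :\ k)) => //; rewrite setD11.
  have [gw|gw] := eqVneq (g (X^~ w)) 0.
    rewrite (_ : xsection _ _ = set0) ?preimage_set0 ?measure0 //.
    by apply/seteqP; split=> // x; rewrite /xsection /= inE => -[].
  apply: (subset_measure0 _ _ _ (X0 k (- h (X^~ w) / g (X^~ w)))).
  - rewrite -[X in measurable X]setTI; apply: measurable_funPT => //.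
    exact: measurable_xsection.
  - by rewrite -[X in measurable X]setTI; exact: measurable_funPT.
  - move=> w'; rewrite /xsection /= inE => -[/= hg _].
    by move/eqP: hg; rewrite addrC addr_eq0 => /eqP <-; rewrite mulfK.
apply: negligibleS (negligibleU g_ae (_ : P.-negligible [set w | E (Y w, X k w)])).
  move=> w /= fw; have [gw|gw] := eqVneq (g (X^~ w)) 0; [by left|right].
  by split; [rewrite /= -fE|exact/eqP].
exists [set w | E (Y w, X k w)]; split=> //.
have mYX : measurable_fun setT (fun w => (Y w, X k w)).
  exact: measurable_fun_pair.
by rewrite -[X in measurable X]setTI; exact: mYX.
Qed.

End Multiaffine.

(** * Rank of the sketched matrix *)

Section Sketch.
Context (R : realType) (m r s : nat).
Hypothesis rs : (r <= s)%N.

Definition minor (C : 'M[R]_(m, r)) (v : 'I_s * 'I_m -> R) : R :=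
  \det (\matrix_(i < r, j < m) v (widen_ord rs i, j) *m C).

(** For [k < r], the entry [(k, l)] affects only row [k] of the product, and affinely, so
    multilinearity of the determinant in its rows applies. For [k >= r] the minor is constant in
    that entry. *)
Lemma minor_multiaffine (C : 'M[R]_(m, r)) : multiaffine (minor C).
Proof.
move=> v [k l] x; rewrite /minor.
have [kr|rk] := ltnP k r; last first.
  have updE y : (\matrix_(i < r, j < m) upd v (k, l) y (widen_ord rs i, j)) =
                \matrix_(i < r, j < m) v (widen_ord rs i, j).
    apply/matrixP => i j; rewrite !mxE /upd; case: eqP => // -[/(congr1 val)/= ik _].
    by move: (ltn_ord i); rewrite ik ltnNge rk.
  by rewrite !updE; ring.
pose M y := \matrix_(i < r, j < m) upd v (k, l) y (widen_ord rs i, j) *m C.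
have row'M y z : row' (Ordinal kr) (M y) = row' (Ordinal kr) (M z).
  rewrite /M !row'Esub -!mul_rowsub_mx; congr (_ *m _).
  apply/matrixP => i j; rewrite !mxE /upd.
  case: eqP => // -[/(congr1 val)/= ik _].
  by have := neq_lift (Ordinal kr) i; rewrite -val_eqE /= ik eqxx.
apply: (@determinant_multilinear _ _ (M x) (M 0) (M 1) (Ordinal kr)) => //.
rewrite /M !row_mul !scalemxAl -mulmxDl; congr (_ *m _).
by apply/rowP => j; rewrite !mxE /upd; case: eqP => _; ring.
Qed.

(** At [C^T] padded with zero rows, the minor is the Gram determinant of the columns of [C], which
    are linearly independent. *)
Lemma minor_neq0 (C : 'M[R]_(m, r)) :
  row_free C^T -> exists v, minor C v != 0.
Proof.
move=> Cfree.
exists (fun ij => if insub (val ij.1) is Some i then C ij.2 i else 0).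
rewrite /minor (_ : \matrix_(i, j) _ = C^T); last first.
  by apply/matrixP => i j; rewrite !mxE /= valK.
by have := gram_unitmx Cfree; rewrite trmxK unitmxE unitfE.
Qed.

Lemma mxrank_sketch (n : nat) (A : 'M[R]_(m, n)) (C : 'M[R]_(m, r))
    (F : 'M[R]_(r, n)) (G : 'M[R]_(s, m)) :
  A = C *m F -> row_free F -> minor C (fun ij => G ij.1 ij.2) != 0 ->
  \rank (G *m A) = \rank A.
Proof.
move=> -> Ffree detGC; apply/eqP; rewrite eqn_leq mxrankM_maxr /=.
rewrite mulmxA 2!(mxrankMfree _ Ffree) // (leq_trans (rank_leq_col C)) //.
have uGC : rowsub (widen_ord rs) (G *m C) \in unitmx.
  rewrite unitmxE unitfE; move: detGC; rewrite /minor.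
  rewrite (_ : _ *m C = rowsub (widen_ord rs) (G *m C)) // -mul_rowsub_mx.
  by congr (_ *m C); apply/matrixP => i j; rewrite !mxE.
by rewrite -{1}(mxrank_unit uGC) mxrankS ?rowsub_sub.
Qed.

End Sketch.

Lemma leq_ceil_mul (R : realType) (gamma : R) (n s : nat) :
  1 < gamma -> s%:Z = Num.ceil (gamma * n%:R) -> (n <= s)%N.
Proof.
move=> g1 hs; rewrite -(ler_nat R) -[s%:R]/(s%:Z%:~R) hs.
apply: le_trans (ceil_ge _); rewrite ler_peMl // ltW //.
Qed.

(** The normal law is absolutely continuous with respect to Lebesgue measure, for which a singleton
    is null. *)
Lemma standard_normal_set1 (d : measure_display) (T : measurableType d)
    (R : realType) (P : probability T R) (X : {RV P >-> R}) (x : R) :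
  standard_normal X -> P (X @^-1` [set x]) = 0%E.
Proof.
move=> nX; rewrite -[LHS]/(distribution P X [set x]) nX //.
apply: (normal_prob_dominates 0 1 (t := [set x])) => //.
by apply/measure0_null_setP => //; exact: lebesgue_measure_set1.
Qed.

Theorem theorem4p1 (R : realType) (m n : nat)
    (A : 'M[R]_(m, n)) (b : 'cV[R]_m)
    (gamma : R) (hgamma : 1 < gamma)
    (s : nat) (hs : s%:Z = Num.ceil (gamma * n%:R))
    (d : measure_display) (T : measurableType d) (P : probability T R)
    (G : 'I_s -> 'I_m -> {RV P >-> R}) (hG : gaussian_entries G)
    (U : forall w : T, 'M[R]_(s, \rank (random_mx G w *m A)))
    (S : forall w : T, 'M[R]_(\rank (random_mx G w *m A)))
    (V : forall w : T, 'M[R]_(n, \rank (random_mx G w *m A)))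
    (hsvd : forall w : T, economy_svd (random_mx G w *m A) (U w) (S w) (V w))
    (yhat : forall w : T, 'cV[R]_(\rank (random_mx G w *m A)))
    (hy : forall w : T,
       min_length_solution (A *m (V w *m invmx (S w))) b (yhat w)) :
  {ae P, forall w : T, V w *m invmx (S w) *m yhat w = mppinv A *m b}.
Proof.
have [normalG indepG] := hG.
(* The oversampling [gamma > 1] gives [n <= s], hence enough rows for a minor of size [\rank A]. *)
have rs : (\rank A <= s)%N.
  exact: leq_trans (rank_leq_col A) (leq_ceil_mul hgamma hs).
pose C := col_base A.
have Cfree : row_free C^T by rewrite /row_free mxrank_tr; exact: col_base_full.
have minor_ae := multiaffine_neq0_ae indepG
  (fun ij x => standard_normal_set1 x (normalG ij.1 ij.2))
  (minor_multiaffine rs C) (depends_on_setT _) (minor_neq0 rs Cfree).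
(* The exceptional set may fail to be measurable, as [V], [S] and [yhat] are arbitrary functions of
   [w]; it is negligible by inclusion in the zero set of the minor. *)
apply: negligibleS minor_ae => w /= notX.
apply: contra_notP notX => /eqP minor_w.
have /min_length_solutionE -> := hy w.
rewrite mulmxA -(mppinv_sketch (hsvd w)) //.
apply: (mxrank_sketch (rs := rs) (esym (mulmx_base A)) (row_base_free A)).
by rewrite (_ : (fun _ => _) = (fun ij => G ij.1 ij.2 w)) //;
  apply/funext => ij; rewrite mxE.
Qed.
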